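(* For each $\varepsilon>0$ there exists $d_0$ such that for each $d\ge d_0$, with high probability $\mathrm{spr}(G_{n,d})<1/4+\varepsilon$.
   Context: $G_{n,d}$ is the uniformly random $d$-regular graph on $\{1,\dots,n\}$ ($n$ even when $d$ is odd); ''with high probability'' means with probability $1-o(1)$ as $n\to\infty$ (for fixed $d$). A Lipschitz function on a graph $G$ is $f:V(G)\to\mathbb{R}$ with $|f(v)-f(w)|\le1$ for adjacent $v,w$; $\mathrm{Var}(f)$ is the variance of $f(X)$ for $X$ uniform on $V(G)$; for connected $G$, $\mathrm{spr}(G)$ is the supremum of $\mathrm{Var}(f)$ over Lipschitz $f$. *)

(* Defs.v *)
From HB Require Import structures.
From mathcomp Require Import all_boot all_order all_algebra.
From mathcomp Require Import boolp reals.
Set Implicit Arguments. Unset Strict Implicit. Unset Printing Implicit Defensive.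
Import Order.TTheory GRing.Theory Num.Theory.
Local Open Scope ring_scope.

(* A graph on vertex set {1..n} (encoded as 'I_n) is given by its set of
   ordered adjacent pairs E. *)
Definition simple_graph (n : nat) (E : {set 'I_n * 'I_n}) : bool :=
  [forall v, forall w, ((v, w) \in E) == ((w, v) \in E)] &&
  [forall v, (v, v) \notin E].

Definition regular (n d : nat) (E : {set 'I_n * 'I_n}) : bool :=
  [forall v, #|[set w | (v, w) \in E]| == d].

(* The sample space of G_{n,d}: all d-regular simple graphs on {1..n},
   each taken with equal probability. *)
Definition regular_graphs (n d : nat) : {set {set 'I_n * 'I_n}} :=
  [set E : {set 'I_n * 'I_n} | simple_graph E && regular d E].

Definition lipschitz (R : realType) (n : nat) (E : {set 'I_n * 'I_n})
    (f : 'I_n -> R) : Prop :=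
  forall v w, (v, w) \in E -> `|f v - f w| <= 1.

Definition mean (R : realType) (n : nat) (f : 'I_n -> R) : R :=
  (\sum_(v < n) f v) / n%:R.

Definition variance (R : realType) (n : nat) (f : 'I_n -> R) : R :=
  (\sum_(v < n) (f v - mean f) ^+ 2) / n%:R.

(* spr(G) < b, i.e. sup { Var f | f Lipschitz } < b
   (the supremum is +oo for disconnected G, in which case this fails). *)
Definition spr_lt (R : realType) (n : nat) (E : {set 'I_n * 'I_n}) (b : R)
    : Prop :=
  exists2 c : R, c < b & forall f : 'I_n -> R, lipschitz E f -> variance f <= c.

Definition prob_spr_lt (R : realType) (n d : nat) (b : R) : R :=
  #|[set E in regular_graphs n d | `[< spr_lt E b >]]|%:R
    / #|regular_graphs n d|%:R.

(* Main.v *)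
Require Import Defs.
From HB Require Import structures.
From mathcomp Require Import all_boot all_order all_algebra.
From mathcomp Require Import boolp reals.
From mathcomp Require Import zify ring lra.
Set Implicit Arguments. Unset Strict Implicit. Unset Printing Implicit Defensive.
Import Order.TTheory GRing.Theory Num.Theory.
Local Open Scope ring_scope.

(* With high probability two properties hold in G_{n,d}, for d large:
   (i) any two disjoint sets of m = n/q + 1 vertices are joined by an edge, and
   (ii) any set A of at most n/16 vertices has more than 2|A| vertices in its
   closed neighbourhood.
   Both say that certain disjoint pairs (A, C) have an edge between them, and
   follow from a union bound over the pairs.  For a single pair, let U_k be the
   set of d-regular graphs with at most k edges between A and C.  Replacing
   edges aa', cc' (a in A, a' not in C, c in C, c' not in A) by ac, a'c' maps
   U_k to U_{k+2}; double counting these switchings shows that U_k is a small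
   fraction of U_{k+2}, and iterating makes U_0 exponentially small.
   Given (i) and (ii), let a be the m-th smallest value of a Lipschitz f and
   c = a + 1/2.  By (i) all but 2m vertices satisfy |f - c| <= 1/2, and by (ii)
   the sets {|f - c| > 1/2 + k} at least halve when k increases by one, so the
   tails contribute only O(m/n) to the mean of (f - c)^2. *)

(** * Double counting and the union bound for finite sets *)

Section Counting.
Local Open Scope nat_scope.

Lemma card_dep_pair (T1 T2 : finType) (S : {set T1}) (Q : T1 -> {set T2}) :
  #|[set x : T1 * T2 | (x.1 \in S) && (x.2 \in Q x.1)]| = \sum_(x in S) #|Q x|.
Proof.
rewrite -sum1_card; under eq_bigl do rewrite inE.
rewrite -(pair_big_dep (fun x => x \in S) (fun x y => y \in Q x) (fun _ _ => 1)).
by apply: eq_bigr => x _; rewrite sum1_card.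
Qed.

Lemma leq_mul_card_bigcup (I T : finType) (P : pred I) (F : I -> {set T}) (x M : nat) :
  (forall i, P i -> #|F i| * x <= M) ->
  #|\bigcup_(i | P i) F i| * x <= #|P| * M.
Proof.
move=> FM; have h: #|\bigcup_(i | P i) F i| <= \sum_(i | P i) #|F i|.
  elim/big_ind2: _ => [|u A y B xA yB|//]; first by rewrite cards0.
  exact: leq_trans (leq_card_setU _ _) (leq_add xA yB).
apply: leq_trans (leq_mul h (leqnn x)) _; rewrite big_distrl /= -sum_nat_const.
exact: leq_sum.
Qed.

End Counting.

(** * Switchings in [d]-regular graphs. An edge appears as two darts, its two ordered pairs *)

Section Switching.
Local Open Scope nat_scope.
Variables (n d : nat).
Implicit Types (E : {set 'I_n * 'I_n}) (A C : {set 'I_n}).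

Definition nbhd E (v : 'I_n) : {set 'I_n} := [set w | (v, w) \in E].

Definition cut E A C := #|[set p in E | (p.1 \in A) && (p.2 \in C)]|.

Definition switch E (a a' c c' : 'I_n) : {set 'I_n * 'I_n} :=
  [set p | (p \in [:: (a, c); (c, a); (a', c'); (c', a')]) ||
           (p \notin [:: (a, a'); (a', a); (c, c'); (c', c)]) && (p \in E)].

Lemma simple_sym E v w : simple_graph E -> ((v, w) \in E) = ((w, v) \in E).
Proof. by case/andP => /forallP/(_ v)/forallP/(_ w)/eqP. Qed.

Lemma simple_irr E v : simple_graph E -> (v, v) \in E = false.
Proof. by case/andP => _ /forallP/(_ v)/negbTE. Qed.

Lemma simple_graphP E : (forall v w, ((v, w) \in E) = ((w, v) \in E)) ->
  (forall v, (v, v) \notin E) -> simple_graph E.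
Proof.
move=> sE iE; apply/andP; split; last exact/forallP.
by apply/forallP => v; apply/forallP => w; rewrite sE.
Qed.

Lemma card_nbhd E v : regular d E -> #|nbhd E v| = d.
Proof. by move/forallP/(_ v)/eqP. Qed.

Lemma card_swap_elt (T : finType) (S : {set T}) x y :
  x \in S -> y \notin S -> #|y |: (S :\ x)| = #|S|.
Proof.
move=> xS yS; rewrite cardsU1 (cardsD1 x S) xS !inE.
by rewrite (negbTE yS) andbF.
Qed.

Section OneSwitch.
Variables (E : {set 'I_n * 'I_n}) (a a' c c' : 'I_n).
Hypotheses (sE : simple_graph E) (rE : regular d E).
Hypotheses (aa' : (a, a') \in E) (cc' : (c, c') \in E).
Hypotheses (ac : (a, c) \notin E) (a'c' : (a', c') \notin E).
Hypotheses (nac : a != c) (na'c' : a' != c') (nac' : a != c') (na'c : a' != c).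

Let naa' : a != a'.
Proof. by apply: contraTneq aa' => <-; rewrite simple_irr. Qed.

Let ncc' : c != c'.
Proof. by apply: contraTneq cc' => <-; rewrite simple_irr. Qed.

Lemma switch_simple : simple_graph (switch E a a' c c').
Proof.
have sym4 (b1 b2 b3 b4 : bool) : [|| b1, b2, b3 | b4] = [|| b2, b1, b4 | b3].
  by case: b1 b2 b3 b4 => [] [] [] [].
apply: simple_graphP => [v w|v]; rewrite !inE !xpair_eqE.
  rewrite (simple_sym v w sE) !(andbC (w == _)).
  by congr (_ || ~~ _ && _); apply: sym4.
rewrite simple_irr // andbF orbF.
apply/negP; do ![case/orP]; case/andP => /eqP e1 /eqP e2; subst;
 by move: nac na'c'; rewrite ?e2 ?eqxx.
Qed.

(** Each of the four vertices trades one neighbour for a new one: [a] trades [a'] for [c], [a']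
    trades [a] for [c'], and symmetrically for [c] and [c']. All other neighbourhoods are
    unchanged. *)
Lemma switch_regular : regular d (switch E a a' c c').
Proof.
have a'a : (a', a) \in E by rewrite simple_sym.
have c'c : (c', c) \in E by rewrite simple_sym.
have ca : (c, a) \notin E by rewrite simple_sym.
have c'a' : (c', a') \notin E by rewrite simple_sym.
have swap v x y : (v, x) \in E -> (v, y) \notin E ->
    #|y |: (nbhd E v :\ x)| = d.
  by move=> vx vy; rewrite card_swap_elt ?inE // card_nbhd.
apply/forallP => v; apply/eqP.
have n1 := negbTE nac; have n2 := negbTE na'c'; have n3 := negbTE nac'.
have n4 := negbTE na'c; have n5 := negbTE naa'; have n6 := negbTE ncc'.
have ns := (n1, n2, n3, n4, n5, n6).
have [->|va] := eqVneq v a.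
  rewrite -(swap a a' c) //; apply: eq_card => w.
  by rewrite !inE !xpair_eqE eqxx ?ns /= ?orbF.
have [->|va'] := eqVneq v a'.
  rewrite -(swap a' a c') //; apply: eq_card => w.
  by rewrite !inE !xpair_eqE eqxx ?[a' == a]eq_sym ?ns /= ?orbF.
have [->|vc] := eqVneq v c.
  rewrite -(swap c c' a) //; apply: eq_card => w.
  by rewrite !inE !xpair_eqE eqxx ?[c == a]eq_sym ?[c == a']eq_sym ?ns /= ?orbF.
have [->|vc'] := eqVneq v c'.
  rewrite -(swap c' c a') //; apply: eq_card => w.
  by rewrite !inE !xpair_eqE eqxx ?[c' == _]eq_sym ?ns /= ?orbF.
rewrite -[RHS](card_nbhd v rE); apply: eq_card => w.
by rewrite !inE !xpair_eqE (negbTE va) (negbTE va') (negbTE vc) (negbTE vc').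
Qed.

(** The inverse of a switching is again a switching, with the middle two vertices exchanged. Hence
    the new graph and the four vertices determine the old graph. *)
Lemma switchK : switch (switch E a a' c c') a c a' c' = E.
Proof.
have a'a : (a', a) \in E by rewrite simple_sym.
have c'c : (c', c) \in E by rewrite simple_sym.
have ca : (c, a) \notin E by rewrite simple_sym.
have c'a' : (c', a') \notin E by rewrite simple_sym.
apply/setP => p; rewrite !inE.
have [->|_] := eqVneq p (a, a'); first by rewrite aa'.
have [->|_] := eqVneq p (a', a); first by rewrite a'a.
have [->|_] := eqVneq p (c, c'); first by rewrite cc' ?orbT.
have [->|_] := eqVneq p (c', c); first by rewrite c'c ?orbT.
have [->|_] := eqVneq p (a, c); first by rewrite (negbTE ac).
have [->|_] := eqVneq p (c, a); first by rewrite (negbTE ca).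
have [->|_] := eqVneq p (a', c'); first by rewrite (negbTE a'c').
have [->|_] := eqVneq p (c', a'); first by rewrite (negbTE c'a').
by [].
Qed.

(** Of the four new darts, those starting at [c] or [c'] do not start in [A], so only [(a, c)] and
    [(a', c')] can be added to the cut. *)
Lemma cut_switch A C : c \notin A -> c' \notin A ->
  cut (switch E a a' c c') A C <= (cut E A C).+2.
Proof.
move=> cA c'A; set S := [set p in E | (p.1 \in A) && (p.2 \in C)].
apply: (@leq_trans #|[set (a, c); (a', c')] :|: S|); last first.
  rewrite (leq_trans (leq_card_setU _ _)) // cards2 /cut -/S.
  by rewrite addnC -addn2 leq_add2l; case: (_ != _).
apply: subset_leq_card; apply/subsetP => p.
rewrite !inE => /andP[/orP[|/andP[_ ->]]]; last by move=> ->; rewrite orbT.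
case/or4P => /eqP-> /=; rewrite ?eqxx ?orbT //.
- by rewrite (negbTE cA).
- by rewrite (negbTE c'A).
Qed.

End OneSwitch.

Lemma card_darts_from E (S : {set 'I_n}) : regular d E ->
  #|[set p in E | p.1 \in S]| = #|S| * d.
Proof.
move=> rE; have := card_dep_pair S (nbhd E).
under eq_bigr do rewrite (card_nbhd _ rE).
rewrite sum_nat_const => <-; apply: eq_card => -[x y].
by rewrite !inE andbC.
Qed.

Lemma card_flip E (P : pred ('I_n * 'I_n)) : simple_graph E ->
  #|[set p in E | P p]| = #|[set p in E | P (p.2, p.1)]|.
Proof.
move=> sE; have flipK : involutive (fun p : 'I_n * 'I_n => (p.2, p.1)) by case.
rewrite -(card_imset _ (can_inj flipK)).
apply: eq_card => -[x y]; rewrite !inE /=.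
apply/imsetP/idP => [[[u v]]|/andP[xy Pxy]].
  by rewrite !inE /= => /andP[uv Puv] [-> ->]; rewrite simple_sym // uv.
by exists (y, x); rewrite // !inE /= simple_sym // xy.
Qed.

Lemma cut_sym E A C : simple_graph E -> cut E A C = cut E C A.
Proof.
move=> sE; rewrite /cut (card_flip (fun p => (p.1 \in A) && (p.2 \in C))) //.
by apply: eq_card => p; rewrite !inE /= [(_ \in A) && _]andbC.
Qed.

Lemma card_darts_avoiding E A C : regular d E ->
  #|[set p in E | (p.1 \in A) && (p.2 \notin C)]| = #|A| * d - cut E A C.
Proof.
move=> rE; rewrite -(card_darts_from A rE) /cut.
set S := [set p in E | p.1 \in A].
rewrite (_ : [set p in E | _ && (_ \in C)] = S :&: [set p | p.2 \in C]); last first.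
  by apply/setP => p; rewrite !inE andbA.
rewrite -[#|S|](cardsID [set p | p.2 \in C]) addnC addnK.
by apply: eq_card => p; rewrite !inE andbA andbC.
Qed.

(** The darts [q] that can be switched with [p]. When [p] leads from [A] to the complement of [C]
    and [A], [C] are disjoint, the other inequalities between the endpoints follow from membership
    in [A] and [C]. *)
Definition partners E A C (p : 'I_n * 'I_n) : {set 'I_n * 'I_n} :=
  [set q in E | [&& q.1 \in C, q.2 \notin A, (p.1, q.1) \notin E,
                    (p.2, q.2) \notin E & p.2 != q.2]].

(** Among the darts from [C] that avoid [A], the unsuitable ones start in the neighbourhood of [p.1]
    ([d * d] darts) or end in the closed neighbourhood of [p.2] ([d.+1 * d] darts). *)
Lemma card_partners E A C p : simple_graph E -> regular d E ->
  #|C| * d - cut E A C - d * d - d.+1 * d <= #|partners E A C p|.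
Proof.
move=> sE rE; rewrite cut_sym // -(card_darts_avoiding C A rE).
set D := [set q in E | _].
set B1 := [set q in E | q.1 \in nbhd E p.1].
set B2 := [set q in E | q.2 \in p.2 |: nbhd E p.2].
have B1d : #|B1| = d * d by rewrite card_darts_from // card_nbhd.
have B2d : #|B2| = d.+1 * d.
  rewrite /B2 (card_flip (fun q => q.2 \in p.2 |: nbhd E p.2)) //=.
  by rewrite card_darts_from // cardsU1 card_nbhd // inE simple_irr.
have : D \subset partners E A C p :|: (B1 :|: B2).
  apply/subsetP => q; rewrite !inE => /and3P[-> -> ->] /=.
  by case: (_ \in E) => //=; case: (_ \in E); rewrite ?orbT //= [q.2 == _]eq_sym;
     case: (_ == _).
move/subset_leq_card => h.
have := leq_of_leqif (leq_card_setU (partners E A C p) (B1 :|: B2)).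
have := leq_of_leqif (leq_card_setU B1 B2); rewrite B1d B2d.
move: h; lia.
Qed.

Definition few_cut A C k : {set {set 'I_n * 'I_n}} :=
  [set E in regular_graphs n d | cut E A C <= k].

(** Switchings are counted from both ends. A graph of [few_cut A C k] allows at least the left-hand
    number of them. A resulting graph is reached at most once for each choice of a dart [ac] in the
    cut, of which there are at most [k.+2], and a dart [a'c'] starting outside [C]. *)
Lemma few_cut_step A C k : [disjoint A & C] ->
  #|few_cut A C k| * ((#|A| * d - k) * (#|C| * d - k - d * d - d.+1 * d))
  <= #|few_cut A C k.+2| * (k.+2 * ((n - #|C|) * d)).
Proof.
move=> dAC.
pose D1 E := [set p in E | (p.1 \in A) && (p.2 \notin C)].
pose fwd E : {set ('I_n * 'I_n) * ('I_n * 'I_n)} :=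
  [set x | (x.1 \in D1 E) && (x.2 \in partners E A C x.1)].
pose rev E : {set ('I_n * 'I_n) * ('I_n * 'I_n)} :=
  setX [set p in E | (p.1 \in A) && (p.2 \in C)] [set p in E | p.1 \in ~: C].
pose Q1 := [set x : {set 'I_n * 'I_n} * _ | (x.1 \in few_cut A C k) && (x.2 \in fwd x.1)].
pose Q2 := [set x : {set 'I_n * 'I_n} * _ | (x.1 \in few_cut A C k.+2) && (x.2 \in rev x.1)].
apply: (@leq_trans #|Q1|).
  rewrite card_dep_pair -sum_nat_const; apply: leq_sum => E.
  rewrite inE => /andP[]; rewrite inE => /andP[sE rE] ck.
  rewrite /fwd card_dep_pair.
  apply: (@leq_trans (\sum_(p in D1 E) (#|C| * d - k - d * d - d.+1 * d))).
    rewrite sum_nat_const leq_mul2r card_darts_avoiding //.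
    by apply/orP; right; lia.
  apply: leq_sum => p _; apply: leq_trans (card_partners A C p sE rE).
  lia.
apply: (@leq_trans #|Q2|); last first.
  rewrite card_dep_pair -sum_nat_const; apply: leq_sum => E.
  rewrite inE => /andP[]; rewrite inE => /andP[sE rE] ck.
  rewrite cardsX leq_mul // card_darts_from // cardsCs setCK card_ord.
  exact: leqnn.
pose phi (x : {set 'I_n * 'I_n} * (('I_n * 'I_n) * ('I_n * 'I_n))) :=
  let: (E, ((a, a'), (c, c'))) := x in (switch E a a' c c', ((a, c), (a', c'))).
have Q1P E a a' c c' : (E, ((a, a'), (c, c'))) \in Q1 ->
  [/\ simple_graph E /\ regular d E, cut E A C <= k,
      [/\ (a, a') \in E, (c, c') \in E, (a, c) \notin E & (a', c') \notin E],
      [/\ a != c, a' != c', a != c' & a' != c] &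
      [/\ a \in A, a' \notin C, c \in C & c' \notin A]].
  rewrite !inE /= => /andP[/andP[/andP[sE rE] ck]].
  case/andP=> /and3P[aa' aA a'C] /and5P[cc' cC c'A ac /andP[a'c' na'c']].
  have nac : a != c.
    by apply: contraTneq aA => ->; rewrite (disjointFl dAC cC).
  split=> //; split=> //; first by apply: contraNneq c'A => <-.
  by apply: contraNneq a'C => ->.
(* [phi] is injective on [Q1], since its value contains the four vertices and [switchK] recovers the
   graph. *)
have <- : #|phi @: Q1| = #|Q1|.
  apply: card_in_imset => -[E [[a a'] [c c']]] [F [[b b'] [e e']]] /Q1P h1 /Q1P h2.
  case=> eEF eab ece ea' ec'; subst b e b' e'; congr (_, _).
  case: h1 => -[sE rE] _ [? ? ? ?] [? ? ? ?] _.
  case: h2 => -[sF rF] _ [? ? ? ?] _ _.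
  by rewrite -(@switchK E a a' c c') // eEF switchK.
apply: subset_leq_card; apply/subsetP => _ /imsetP[[E [[a a'] [c c']]] + ->].
case/Q1P => -[sE rE] ck [? ? ? ?] [? ? ? ?] [aA a'C cC c'A].
rewrite !inE /= switch_simple // switch_regular //= aA cC a'C !eqxx /= ?orbT !andbT.
by rewrite (leq_trans (@cut_switch E a a' c c' A C _ _)) // (disjointFl dAC cC).
Qed.

(** Iterates [few_cut_step] along cut sizes 0, 2, ..., [J.*2]. Here [F] bounds the number of
    switchings below at every stage, and each stage gains a factor of at most [y / x]. *)
Lemma few_cut0_bound A C (J x y F : nat) : [disjoint A & C] -> 0 < F ->
  F <= (#|A| * d - J.*2) * (#|C| * d - J.*2 - d * d - d.+1 * d) ->
  x * (J.*2 * ((n - #|C|) * d)) <= y * F ->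
  #|few_cut A C 0| * x ^ J <= y ^ J * #|regular_graphs n d|.
Proof.
move=> dAC F0 FJ xy.
suff h j : j <= J -> #|few_cut A C 0| * x ^ j <= y ^ j * #|few_cut A C j.*2|.
  apply: leq_trans (h J (leqnn J)) _; rewrite leq_mul2l; apply/orP; right.
  by apply: subset_leq_card; apply/subsetP => E; rewrite inE => /andP[].
elim: j => [|j IHj] jJ; first by rewrite !expn0 muln1 mul1n.
have step : #|few_cut A C j.*2| * x <= y * #|few_cut A C j.+1.*2|.
  rewrite -(leq_pmul2r F0).
  have := few_cut_step j.*2 dAC; rewrite -doubleS => hs.
  have h1 : #|few_cut A C j.*2| * F <= #|few_cut A C j.+1.*2| * (J.*2 * ((n - #|C|) * d)).
    apply: leq_trans (leq_trans hs _).
      rewrite leq_mul2l; apply/orP; right; apply: leq_trans FJ _.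
      by apply: leq_mul; lia.
    by rewrite leq_mul2l leq_mul2r leq_double jJ !orbT.
  rewrite mulnAC; apply: leq_trans (leq_mul h1 (leqnn x)) _.
  rewrite -mulnA [_ * x]mulnC [y * _]mulnC -[leqRHS]mulnA leq_mul2l.
  by rewrite xy orbT.
rewrite !expnSr mulnA; apply: leq_trans (leq_mul (IHj (ltnW jJ)) (leqnn x)) _.
by rewrite -!mulnA leq_mul2l step orbT.
Qed.

End Switching.

(** * Union bounds over the pairs of vertex sets *)

Section UnionBounds.
Local Open Scope nat_scope.

(** The falling factorial of [2a] of length [a] has all factors at least [a]; it equals [a!] times a
    central binomial coefficient, which is one term of [(1 + 1) ^ (2a)]. *)
Lemma leq_exp_fact a : a ^ a <= 4 ^ a * a`!.
Proof.
have h1 : a ^ a <= (a + a) ^_ a.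
  rewrite ffact_prod -[X in _ ^ X]card_ord -prod_nat_const.
  by apply: leq_prod => i _; have := ltn_ord i; lia.
have h2 : 'C(a + a, a) <= 4 ^ a.
  rewrite (_ : 4 ^ a = (1 + 1) ^ (a + a)); last by rewrite (addnn a) -mul2n (expnM 2 2 a).
  rewrite expnDn (bigD1 (inord a)) //= inordK; last by lia.
  by rewrite !exp1n !muln1 leq_addr.
by apply: leq_trans h1 _; rewrite -bin_ffact leq_mul2r h2 orbT.
Qed.

Lemma leq_bin_exp n a : 'C(n, a) * a ^ a <= (4 * n) ^ a.
Proof.
apply: (@leq_trans ('C(n, a) * (4 ^ a * a`!))).
  by rewrite leq_mul2l leq_exp_fact orbT.
rewrite mulnCA bin_ffact expnMn leq_mul2l; apply/orP; right.
rewrite ffact_prod -[X in _ <= _ ^ X](card_ord a) -prod_nat_const.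
by apply: leq_prod => i _; rewrite leq_subr.
Qed.

(** After cancelling one factor [n], it suffices that [a <= 16 ^ (a - 1)]. *)
Lemma leq_exp_self n a : 0 < a -> 16 * a <= n -> a ^ a * n <= n ^ a.
Proof.
case: a => // a _ an; rewrite expnSr -mulnA [n ^ _]expnSr mulnA leq_mul2r.
apply/orP; right; apply: (@leq_trans ((16 * a.+1) ^ a)); last first.
  by case: a an => // a an; rewrite leq_exp2r.
rewrite expnMn mulnC leq_mul2r; apply/orP; right.
by elim: a {an} => // a; rewrite expnS; lia.
Qed.

Section Bounds.
Variables (n d : nat).
Let Omega := #|regular_graphs n d|.

(** Uses [J = 3n] switching steps, each gaining a factor 1/2. The resulting [2 ^ (- 3n)] is meant to
    beat the at most [4 ^ n] pairs of sets. *)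
Lemma few_cut0_large (A C : {set 'I_n}) q m : #|A| = m -> #|C| = m ->
  [disjoint A & C] -> 0 < n -> 96 * (q * q) <= d -> n <= q * m -> 12 * d <= m ->
  #|few_cut d A C 0| * 2 ^ (3 * n) <= Omega.
Proof.
move=> Am Cm dAC n0 qd qm dm.
have q0 : 0 < q by case: q qm {qd} => //; lia.
set F := (m * d - (3 * n).*2) * (m * d - (3 * n).*2 - d * d - d.+1 * d).
have Mn : 96 * n <= m * d.
  apply: (@leq_trans (m * (96 * (q * q)))); last by rewrite leq_mul2l qd orbT.
  by nia.
have Md : 12 * (d * d) <= m * d by rewrite mulnA leq_mul2r dm orbT.
have dd : d <= d * d by nia.
have h1 : m * d <= 2 * (m * d - (3 * n).*2) by lia.
have h2 : m * d <= 4 * (m * d - (3 * n).*2 - d * d - d.+1 * d).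
  by rewrite mulSn; lia.
have h3 : 96 * (d * (n * n)) <= (m * d) * (m * d).
  apply: (@leq_trans (96 * (d * ((q * m) * (q * m))))).
    by rewrite !leq_mul2l leq_mul ?orbT.
  rewrite (_ : _ * _ = (96 * (q * q)) * (d * (m * m))); last by ring.
  rewrite (_ : (m * d) * _ = d * (d * (m * m))); last by ring.
  by rewrite leq_mul2r qd orbT.
have h4 : (m * d) * (m * d) <= 8 * F.
  by apply: leq_trans (leq_mul h1 h2) _; rewrite mulnACA.
have d0 : 0 < d by nia.
have F12 : 12 * (d * (n * n)) <= F.
  by rewrite -(leq_pmul2l (isT : 0 < 8)) mulnA; apply: leq_trans h3 h4.
have F0 : 0 < F by apply: leq_trans F12; rewrite !muln_gt0 d0 n0.
have := @few_cut0_bound n d A C (3 * n) 2 1 F dAC F0.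
rewrite Am Cm exp1n !mul1n; apply=> //.
apply: leq_trans F12.
rewrite (_ : 12 * (d * (n * n)) = 2 * ((3 * n).*2 * (n * d))).
  by rewrite !leq_mul2l leq_mul2r leq_subr !orbT.
by rewrite -mul2n; ring.
Qed.

(** Since only [2a] vertices lie outside [C], there are few reverse switchings, and each of the
    [J = 6a] steps gains a factor [a / n]. *)
Lemma few_cut0_small (A C : {set 'I_n}) a : #|A| = a -> #|C| = n - a.*2 ->
  [disjoint A & C] -> 0 < a -> 96 <= d -> 16 * a <= n -> 24 * d <= n ->
  #|few_cut d A C 0| * n ^ (6 * a) <= a ^ (6 * a) * Omega.
Proof.
move=> Aa Ca dAC a0 d96 an dn.
set F := (a * d - (6 * a).*2) * ((n - a.*2) * d - (6 * a).*2 - d * d - d.+1 * d).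
have h1 : a * d <= 2 * (a * d - (6 * a).*2) by nia.
have dd : d <= d * d by nia.
have nd : 24 * (d * d) <= n * d by rewrite mulnA leq_mul2r dn orbT.
have ad : 16 * (a * d) <= n * d by rewrite mulnA leq_mul2r an orbT.
have aad : 96 * a <= a * d by rewrite mulnC leq_mul2l d96 orbT.
have h2 : n * d <= 2 * ((n - a.*2) * d - (6 * a).*2 - d * d - d.+1 * d).
  by rewrite mulSn mulnBl -(mul2n a) -(mulnA 2 a d); lia.
have h3 : (a * d) * (n * d) <= 4 * F.
  by apply: leq_trans (leq_mul h1 h2) _; rewrite mulnACA.
have F0 : 0 < F.
  rewrite -(ltn_pmul2l (isT : 0 < 4)) muln0; apply: leq_trans h3.
  by rewrite !muln_gt0; lia.
have := @few_cut0_bound n d A C (6 * a) n a F dAC F0.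
rewrite Aa Ca; apply=> //.
rewrite subKn; last by lia.
rewrite -(leq_pmul2l (isT : 0 < 4)) [leqRHS]mulnCA.
apply: leq_trans (leq_mul (leqnn a) h3).
rewrite -!mul2n.
rewrite (_ : 4 * _ = (a * a * n * d) * 96); last by ring.
rewrite [leqRHS](_ : _ = (a * a * n * d) * d); last by ring.
by rewrite leq_mul2l d96 orbT.
Qed.

Definition unjoined m : {set {set 'I_n * 'I_n}} :=
  \bigcup_(p : {set 'I_n} * {set 'I_n} |
    [&& #|p.1| == m, #|p.2| == m & [disjoint p.1 & p.2]]) few_cut d p.1 p.2 0.

(** The union bound leaves a proportion of at most [2 ^ (- n)], which is below [1 / n]. *)
Lemma card_unjoined q m : 0 < n -> 96 * (q * q) <= d -> n <= q * m ->
  12 * d <= m -> #|unjoined m| * n <= Omega.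
Proof.
move=> n0 qd qm dm.
have h : #|unjoined m| * 2 ^ (3 * n) <= 2 ^ (2 * n) * Omega.
  apply: leq_trans (leq_mul_card_bigcup (M := Omega) _) _.
    move=> [A C] /and3P[/eqP Am /eqP Cm dAC].
    exact: few_cut0_large qd qm dm.
  rewrite leq_mul2r; apply/orP; right; apply: leq_trans (max_card _) _.
  rewrite card_prod.
  have -> : #|{set 'I_n}| = 2 ^ n by rewrite -cardsT -powersetT card_powerset cardsT card_ord.
  by rewrite -expnD addnn mul2n.
have : #|unjoined m| * 2 ^ n <= Omega.
  rewrite -(leq_pmul2l (expn_gt0 2 (2 * n))) mulnCA -expnD.
  by rewrite (_ : 2 * n + n = 3 * n) //; lia.
apply: leq_trans; rewrite leq_mul2l; apply/orP; right.
exact/ltnW/ltn_expl.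
Qed.

(** A set of [a] vertices has a closed neighbourhood of at most [2a] vertices exactly when some
    [n - 2a] vertices outside it receive no edge from it. *)
Definition unexpanding a : {set {set 'I_n * 'I_n}} :=
  \bigcup_(p : {set 'I_n} * {set 'I_n} |
    [&& #|p.1| == a, #|p.2| == n - a.*2 & [disjoint p.1 & p.2]])
    few_cut d p.1 p.2 0.

(** There are at most [16^a (n/a)^(3a)] pairs, each of probability at most [(a/n)^(6a)]. As
    [16a <= n], the product is at most [(a/n)^(2a)], which [leq_exp_self] bounds by [1 / n^2]. The
    square leaves room to sum over [a]. *)
Lemma card_unexpanding a : 0 < a -> 96 <= d -> 16 * a <= n -> 24 * d <= n ->
  #|unexpanding a| * n ^ 2 <= Omega.
Proof.
move=> a0 d96 an dn.
have n0 : 0 < n by lia.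
have h : #|unexpanding a| * n ^ (6 * a) <=
    ('C(n, a) * 'C(n, a.*2)) * (a ^ (6 * a) * Omega).
  apply: leq_trans (leq_mul_card_bigcup (M := a ^ (6 * a) * Omega) _) _.
    move=> [A C] /and3P[/eqP Aa /eqP Ca dAC].
    exact: few_cut0_small.
  rewrite leq_mul2r; apply/orP; right.
  have <- : #|setX [set A : {set 'I_n} | #|A| == a] [set A : {set 'I_n} | #|A| == n - a.*2]|
      = 'C(n, a) * 'C(n, a.*2).
    rewrite cardsX !card_draws card_ord bin_sub //; lia.
  apply: subset_leq_card; apply/subsetP => -[A C].
  by rewrite !inE => /and3P[-> ->].
have b1 := leq_bin_exp n a.
have b2 : 'C(n, a.*2) * a ^ a.*2 <= (2 * n) ^ a.*2.
  have := leq_bin_exp n a.*2.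
  rewrite (_ : a.*2 ^ a.*2 = 2 ^ a.*2 * a ^ a.*2); last by rewrite -expnMn mul2n.
  rewrite (_ : (4 * n) ^ a.*2 = 2 ^ a.*2 * (2 * n) ^ a.*2).
    by rewrite mulnCA leq_pmul2l // expn_gt0.
  by rewrite -expnMn mulnA.
have b3 : (4 * n) ^ a * (2 * n) ^ a.*2 = 16 ^ a * n ^ (3 * a).
  rewrite !expnMn mulnACA -expnD -mul2n [2 ^ _]expnM -expnMn.
  by congr (_ * _ ^ _); lia.
have h2 : #|unexpanding a| * n ^ (3 * a) <= 16 ^ a * a ^ (3 * a) * Omega.
  (* Multiplying by this factor clears the denominators of [b1] and [b2]. *)
  have e0 : 0 < n ^ (3 * a) * a ^ (3 * a) by rewrite muln_gt0 !expn_gt0 n0 a0.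
  rewrite -(leq_pmul2r e0).
  have e1 : n ^ (6 * a) = n ^ (3 * a) * n ^ (3 * a) by rewrite -expnD; congr (_ ^ _); lia.
  have e2 : a ^ (6 * a) = a ^ (3 * a) * a ^ (3 * a) by rewrite -expnD; congr (_ ^ _); lia.
  have e3 : a ^ (3 * a) = a ^ a * a ^ a.*2 by rewrite -expnD; congr (_ ^ _); lia.
  have h' := leq_mul h (leqnn (a ^ (3 * a))).
  have b' := leq_mul b1 b2; rewrite mulnACA -e3 b3 in b'.
  have b'' := leq_mul b' (leqnn (a ^ (6 * a) * Omega)).
  move: h' b''; rewrite e1 e2.
  set X := a ^ (3 * a); set Y := n ^ (3 * a); set B := 'C(_, _) * _.
  set Z := 16 ^ a; set U := #|_| => h' b''.
  rewrite (_ : U * Y * (Y * X) = U * (Y * Y) * X); last by ring.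
  apply: leq_trans h' _.
  rewrite (_ : B * _ * X = B * X * (X * X * Omega)); last by ring.
  apply: leq_trans b'' _; rewrite leq_eqVlt; apply/orP; left; apply/eqP; ring.
have h3 : #|unexpanding a| * n ^ (2 * a) <= a ^ (2 * a) * Omega.
  rewrite -(leq_pmul2r (_ : 0 < n ^ a)) ?expn_gt0 ?n0 // -mulnA -expnD.
  rewrite (_ : 2 * a + a = 3 * a); last by lia.
  apply: leq_trans h2 _; rewrite [leqRHS]mulnAC leq_mul2r; apply/orP; right.
  rewrite (_ : 3 * a = a + 2 * a); last by lia.
  rewrite expnD mulnA -expnMn mulnC leq_mul2l; apply/orP; right.
  by rewrite leq_exp2r.
rewrite -(leq_pmul2r (_ : 0 < a ^ (2 * a))) ?expn_gt0 ?a0 //.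
rewrite [leqRHS]mulnC; apply: leq_trans h3.
rewrite -mulnA leq_mul2l; apply/orP; right.
rewrite [2 * a]mulnC !expnM mulnC -expnMn leq_exp2r //.
exact: leq_exp_self.
Qed.

Definition unexpanding_any : {set {set 'I_n * 'I_n}} :=
  \bigcup_(a : 'I_n | (0 < a) && (16 * a <= n)) unexpanding a.

Lemma card_unexpanding_any : 96 <= d -> 24 * d <= n ->
  #|unexpanding_any| * n <= Omega.
Proof.
move=> d96 dn; have n0 : 0 < n by lia.
rewrite -(leq_pmul2l n0) mulnCA mulnn.
apply: leq_trans (leq_mul_card_bigcup (M := Omega) _) _.
  by move=> a /andP[a0 an]; apply: card_unexpanding.
by rewrite leq_mul2r (leq_trans (max_card _)) ?card_ord ?orbT.
Qed.

End Bounds.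
End UnionBounds.

(** * Existence of regular graphs, so that the sample space is nonempty *)

Section Existence.
Variable n : nat.

Lemma card_two_torsion : (#|[set x : 'I_n.+1 | (x + x == 0)%R]| <= 2)%N.
Proof.
apply: (@leq_trans #|[set (0 : 'I_n.+1); inord n.+1./2]|).
  apply: subset_leq_card; apply/subsetP => x; rewrite !inE => /eqP xx0.
  have /= h := congr1 (@nat_of_ord n.+1) xx0.
  have xn := ltn_ord x.
  have [x0|x0] := posnP x; first by apply/orP; left; apply/eqP/val_inj.
  apply/orP; right; apply/eqP/val_inj; rewrite /= inordK; last by lia.
  have : (n.+1 %| x + x)%N by apply/eqP.
  case/dvdnP => -[|[|k]] e; lia.
by rewrite cards2; case: (_ != _).
Qed.

(** Pairs [x], [- x] are added one at a time; the at most two elements with [x = - x] are avoided,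
    and the size hypothesis leaves a free element. *)
Lemma symmetric_subset_exists k : (k.*2.+2 <= n.+1)%N ->
  exists2 D : {set 'I_n.+1}, #|D| = k.*2 &
    forall x, x \in D -> - x \in D /\ x + x != 0.
Proof.
elim: k => [|k IHk] kn; first by exists set0 => [|x]; rewrite ?cards0 ?inE.
have {IHk} [D Dk DP] := IHk ltac:(lia).
pose T := [set x : 'I_n.+1 | x + x == 0].
have : (0 < #|~: (D :|: T)|)%N.
  have h := leq_of_leqif (leq_card_setU D T).
  have := card_two_torsion; rewrite -/T => hT.
  rewrite cardsCs setCK card_ord; move: h; rewrite Dk; move: hT kn.
  by set u := #|T|; set w := #|_ :|: _|; lia.
case/card_gt0P => x; rewrite !inE negb_or => /andP[xD xT].
have NxD : - x \notin D by apply: contra xD => /DP[]; rewrite opprK.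
have NxT : - x + - x != 0 by rewrite -opprD oppr_eq0.
have xNx : x != - x by rewrite -addr_eq0.
exists (x |: (- x |: D)).
  by rewrite !cardsU1 !inE negb_or xNx xD NxD Dk; lia.
move=> y; rewrite !inE => /or3P[/eqP->|/eqP->|/DP[yD ->]].
- by rewrite eqxx orbT.
- by rewrite opprK eqxx.
- by rewrite yD !orbT.
Qed.

(** A Cayley graph of the integers modulo [n.+1] with a symmetric connection set [D] of size [d] is
    [d]-regular. For odd [d] the modulus is even, and its half, the element of order two, joins the
    paired elements. *)
Lemma regular_graphs_gt0 d : (d.+3 <= n.+1)%N -> ~~ odd (n.+1 * d) ->
  (0 < #|regular_graphs n.+1 d|)%N.
Proof.
move=> dn nd.
have [D Dd [Ds D0]] : exists2 D : {set 'I_n.+1}, #|D| = d &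
    (forall x, x \in D -> - x \in D) /\ 0 \notin D.
  have [|D Dk DP] := @symmetric_subset_exists d./2; first by lia.
  have D0 : 0 \notin D by apply/negP => /DP[_]; rewrite addr0 eqxx.
  have [od|ed] := boolP (odd d); last first.
    by exists D; [rewrite Dk; lia | split=> // x /DP[]].
  have en : ~~ odd n.+1 by move: nd; rewrite oddM od andbT.
  pose h : 'I_n.+1 := inord n.+1./2.
  have vh : val h = n.+1./2 by rewrite /h /= inordK //; lia.
  have hh : h + h = 0.
    apply: val_inj; rewrite /= -[nat_of_ord h]/(val h) vh.
    by rewrite (_ : (_ + _)%N = n.+1) ?modnn //; lia.
  have h0 : h != 0.
    by apply/eqP => h0; have := congr1 val h0; rewrite vh /=; lia.
  have hD : h \notin D by apply/negP => /DP[_]; rewrite hh eqxx.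
  exists (h |: D); first by rewrite cardsU1 hD Dk; lia.
  split=> [x|]; last by rewrite !inE eq_sym negb_or h0.
  rewrite !inE => /orP[/eqP->|/DP[-> _]]; last by rewrite orbT.
  by rewrite eq_sym -addr_eq0 hh eqxx.
apply/card_gt0P; exists [set p | p.2 - p.1 \in D]; rewrite inE; apply/andP; split.
  apply: simple_graphP => [v w|v]; rewrite !inE /= ?subrr //.
  by apply/idP/idP => /Ds; rewrite opprB.
apply/forallP => v; apply/eqP; rewrite -Dd -(card_imset D (addIr v)).
apply: eq_card => w; rewrite !inE /=; apply/idP/imsetP => [wv|[x xD ->]].
  by exists (w - v); rewrite // subrK.
by rewrite addrK.
Qed.

End Existence.

(** * The variance of a Lipschitz function on an expanding graph *)

Section Deterministic.
Variables (R : realType) (n : nat).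
Implicit Types (E : {set 'I_n * 'I_n}) (A C : {set 'I_n}) (f : 'I_n -> R).

(** The two sides differ by [n] times the square of [mean f - c]. This allows the variance to be
    estimated around a convenient centre. *)
Lemma sumsq_mean_le f (c : R) : (0 < n)%N ->
  \sum_v (f v - mean f) ^+ 2 <= \sum_v (f v - c) ^+ 2.
Proof.
move=> n0; set mu := mean f.
have nR : (n%:R : R) != 0 by rewrite pnatr_eq0 -lt0n.
have smu : \sum_v (f v - mu) = 0.
  rewrite big_split /= sumr_const card_ord.
  by rewrite /mu /mean -[(- _) *+ n]mulr_natr mulNr divfK // subrr.
have -> : \sum_v (f v - c) ^+ 2 =
    \sum_v (f v - mu) ^+ 2 + \sum_(v < n) (mu - c) ^+ 2.
  have : \sum_v ((f v - c) ^+ 2 - (f v - mu) ^+ 2 - (mu - c) ^+ 2) = 0.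
    rewrite (eq_bigr (fun v => (f v - mu) * (2 * (mu - c)))); last by move=> v _; ring.
    by rewrite -mulr_suml smu mul0r.
  by rewrite !sumrB => /eqP; rewrite subr_eq0 subr_eq addrC => /eqP.
by rewrite lerDl sumr_ge0 // => v _; rewrite sqr_ge0.
Qed.

(** Take [v] with least value among those having [m] values at or below. If [m] values were strictly
    below, the largest of them would contradict minimality. *)
Lemma quantile_exists f (m : nat) : (0 < m <= n)%N ->
  exists v, (m <= #|[set w | (f w <= f v)%R]|)%N /\ (#|[set w | (f w < f v)%R]| < m)%N.
Proof.
case/andP => m0 mn.
have n0 : (0 < n)%N by lia.
pose i0 := Ordinal n0.
pose P v := (m <= #|[set w | (f w <= f v)%R]|)%N.
have [top _ topP] := @arg_maxP _ _ _ i0 xpredT f isT.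
have Ptop : P top.
  rewrite /P (_ : [set w | _] = setT) ?cardsT ?card_ord //.
  by apply/setP => w; rewrite !inE; apply: topP.
have [v Pv vmin] := @arg_minP _ _ _ top P f Ptop.
exists v; split=> //; rewrite ltnNge; apply/negP => mv.
have /card_gt0P[w0] : (0 < #|[set w | (f w < f v)%R]|)%N by lia.
rewrite inE => w0v.
have [w wv wmax] := @arg_maxP _ _ _ w0 (fun w => f w < f v) f w0v.
have /vmin : P w.
  apply: leq_trans mv _; apply: subset_leq_card; apply/subsetP => u.
  by rewrite !inE => /wmax.
by rewrite leNgt wv.
Qed.

(* The tail of the sum is absorbed since sum_(k >= K) (2 k + 2) 2^(K - k) = 4 K + 8. *)
Lemma sum_halving (s : nat -> nat) : (forall k, 2 * s k.+1 <= s k)%N ->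
  forall K, (\sum_(k < K) (2 * k + 2) * s k + (4 * K + 8) * s K <= 8 * s 0)%N.
Proof.
move=> hs; elim=> [|K IHK]; first by rewrite big_ord0; lia.
rewrite big_ord_recr /=; move: IHK (leq_mul (leqnn (2 * K + 6)) (hs K)).
by set S := (\sum_(k < K) _)%N; lia.
Qed.

(** The weight [2k + 2] is the increment of the square from [1/2 + k] to [1/2 + k + 1]. The separate
    [y] lets the induction lower the bounded value while the indicators stay fixed. *)
Lemma sqr_le_layers (x y : R) K : 0 <= y -> y <= `|x| -> y <= 2^-1 + K%:R ->
  y ^+ 2 <= 4^-1 + \sum_(k < K) (2 * k + 2)%:R * (2^-1 + k%:R < `|x|)%R%:R.
Proof.
elim: K y => [|K IHK] y y0 yx yK.
  by rewrite big_ord0 addr0; move: yK; rewrite addr0; nra.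
rewrite big_ord_recr /=.
have [yK'|yK'] := leP y (2^-1 + K%:R).
  by apply: le_trans (IHK _ y0 yx yK') _; rewrite lerD2l lerDl mulr_ge0.
have Kx : 2^-1 + K%:R < `|x| by apply: lt_le_trans yx.
have K0 : 0 <= K%:R :> R by [].
rewrite Kx mulr1 addrA.
apply: (@le_trans _ _ ((2^-1 + K%:R) ^+ 2 + (2 * K + 2)%:R)); last first.
  by rewrite lerD2r; apply: IHK; [rewrite addr_ge0 ?invr_ge0|exact: ltW|].
move: yK yK' K0; rewrite natrD natrM -[K.+1%:R]natr1.
by move: (K%:R : R) => k; nra.
Qed.

Definition has_edge E A C := exists v w, [/\ v \in A, w \in C & (v, w) \in E].

Lemma variance_le E f m : lipschitz E f -> (0 < m)%N -> (32 * m <= n)%N ->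
  (forall A C, (m <= #|A|)%N -> (m <= #|C|)%N -> [disjoint A & C] ->
     has_edge E A C) ->
  (forall A C, (0 < #|A|)%N -> (16 * #|A| <= n)%N -> (n - #|A|.*2 <= #|C|)%N ->
     [disjoint A & C] -> has_edge E A C) ->
  variance f <= 4^-1 + (16 * m)%:R / n%:R.
Proof.
move=> Lf m0 mn joined expanding.
have n0 : (0 < n)%N by lia.
have nR : (0 : R) < n%:R by rewrite ltr0n.
have [v0 [lo1 lo2]] := @quantile_exists f m ltac:(lia).
set a := f v0 in lo1 lo2.
(* An edge from a value at most [a] to one above [a + 1] would break the Lipschitz condition. *)
have hi : (#|[set w | (a + 1 < f w)%R]| < m)%N.
  rewrite ltnNge; apply/negP => hi.
  have [|v [w [va wa]]] := joined _ _ lo1 hi.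
    rewrite disjoints_subset; apply/subsetP => w; rewrite !inE => wa.
    by rewrite -leNgt; lra.
  by move/Lf; rewrite !inE in va wa; rewrite distrC ler_norml; lra.
pose c := a + 2^-1.
pose W k := [set v | (2^-1 + k%:R < `|f v - c|)%R].
have W0 : (#|W 0%N| <= 2 * m)%N.
  apply: (@leq_trans #|[set w | (f w < a)%R] :|: [set w | (a + 1 < f w)%R]|).
    apply: subset_leq_card; apply/subsetP => v.
    by rewrite !inE addr0 ltr_normr /c => /orP[] h; apply/orP; [right|left]; lra.
  have := leq_of_leqif (leq_card_setU [set w | (f w < a)%R] [set w | (a + 1 < f w)%R]).
  lia.
have Wmono k : W k.+1 \subset W k.
  by apply/subsetP => v; rewrite !inE -[k.+1%:R]natr1; lra.
have W0mono k : (#|W k| <= 2 * m)%N.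
  by elim: k => // k IHk; apply: leq_trans (subset_leq_card (Wmono k)) IHk.
(* No edge joins [W k.+1] to the complement of [W k], because [f] changes by at most one along
   edges. If halving failed, that complement would be large enough for expansion to give such an
   edge. *)
have Whalf k : (2 * #|W k.+1| <= #|W k|)%N.
  rewrite leqNgt; apply/negP => Wk.
  have [||||v [w [vW wW]]] := expanding (W k.+1) (~: W k).
  - by rewrite lt0n; apply: contraTneq Wk => ->; rewrite muln0.
  - by apply: leq_trans mn; rewrite -[32%N]/(16 * 2)%N -mulnA leq_mul2l W0mono orbT.
  - by rewrite [leqRHS]cardsCs setCK card_ord leq_sub2l // -mul2n ltnW.
  - by rewrite disjoints_subset setCK.
  move/Lf => vw; rewrite !inE -leNgt -?[k.+1%:R]natr1 in vW wW.
  have := ler_normD (f v - f w) (f w - c).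
  by rewrite addrA subrK; lra.
have Wpow k : (2 ^ k * #|W k| <= #|W 0%N|)%N.
  elim: k => [|k IHk]; first by rewrite mul1n.
  by rewrite expnSr -mulnA (leq_trans _ IHk) // leq_mul2l Whalf orbT.
(* Halving [n] times empties the set, as [n < 2 ^ n]; so [n] layers suffice. *)
have Wn : W n = set0.
  apply: contraTeq (Wpow n); rewrite -card_gt0 -ltnNge => Wn.
  apply: leq_ltn_trans (max_card _) _; rewrite card_ord.
  by apply: leq_trans (ltn_expl n (isT : (1 < 2)%N)) _; rewrite leq_pmulr.
have layer v : (f v - c) ^+ 2 <=
    4^-1 + \sum_(k < n) (2 * k + 2)%:R * (v \in W k)%:R.
  rewrite -real_normK ?num_real //.
  have vW : v \notin W n by rewrite Wn inE.
  rewrite inE -leNgt in vW.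
  apply: le_trans (@sqr_le_layers (f v - c) `|f v - c| n _ _ vW) _ => //.
  by rewrite lerD2l ler_sum // => k _; rewrite inE.
rewrite /variance ler_pdivrMr //.
apply: le_trans (sumsq_mean_le f c n0) _.
apply: le_trans (ler_sum _ (fun v _ => layer v)) _.
rewrite mulrDl divfK; last by rewrite gt_eqF.
rewrite big_split /= sumr_const card_ord -[4^-1 *+ n]mulr_natr lerD2l exchange_big /=.
apply: (@le_trans _ _ (\sum_(k < n) (2 * k + 2) * #|W k|)%N%:R); last first.
  by rewrite ler_nat; have := sum_halving Whalf n; lia.
rewrite natr_sum ler_sum // => k _.
by rewrite -mulr_sumr natrM -natr_sum -big_mkcond /= sum1_card.
Qed.

End Deterministic.

(** * From the two edge properties to the probability bound *)

Section Assembly.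
Local Open Scope nat_scope.

Lemma subset_of_card (T : finType) (A : {set T}) m : m <= #|A| ->
  exists2 B : {set T}, B \subset A & #|B| = m.
Proof.
case/card_geqP => s [us sm sA]; exists [set x in s].
  by apply/subsetP => x; rewrite inE => /sA.
by rewrite cardsE (card_uniqP us).
Qed.

Variables (n d : nat).
Implicit Types (E : {set 'I_n * 'I_n}) (A C : {set 'I_n}).

Lemma has_edge_few_cut E A C : E \in regular_graphs n d ->
  E \notin few_cut d A C 0 -> has_edge E A C.
Proof.
move=> rE; rewrite inE rE /= -ltnNge => /card_gt0P[[v w]].
by rewrite !inE => /and3P[? ? ?]; exists v, w.
Qed.

Lemma has_edge_sub E A C A' C' : A' \subset A -> C' \subset C ->
  has_edge E A' C' -> has_edge E A C.
Proof.
by move=> /subsetP sA /subsetP sC [v [w [/sA ? /sC ? ?]]]; exists v, w.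
Qed.

Lemma disjoint_sub A C A' C' : A' \subset A -> C' \subset C ->
  [disjoint A & C] -> [disjoint A' & C'].
Proof. by move=> sA sC dAC; rewrite (disjointWl sA) // (disjointWr sC). Qed.

(** [unjoined] speaks of sets of size exactly [m], so larger sets are first shrunk. *)
Lemma has_edge_joined E m A C : E \in regular_graphs n d ->
  E \notin unjoined n d m -> m <= #|A| -> m <= #|C| -> [disjoint A & C] ->
  has_edge E A C.
Proof.
move=> rE nE /subset_of_card[A' sA Am] /subset_of_card[C' sC Cm] dAC.
apply: (has_edge_sub sA sC); apply: has_edge_few_cut => //.
apply: contra nE => EAC; apply/bigcupP; exists (A', C') => //=.
by rewrite Am Cm eqxx (disjoint_sub sA sC).
Qed.

Lemma has_edge_expanding E A C : E \in regular_graphs n d ->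
  E \notin unexpanding_any n d -> 0 < #|A| -> 16 * #|A| <= n ->
  n - #|A|.*2 <= #|C| -> [disjoint A & C] -> has_edge E A C.
Proof.
move=> rE nE A0 An /subset_of_card[C' sC Cm] dAC.
apply: (has_edge_sub (subxx A) sC); apply: has_edge_few_cut => //.
have lt_An : #|A| < n by lia.
apply: contra nE => EAC; apply/bigcupP; exists (Ordinal lt_An); first by rewrite A0.
apply/bigcupP; exists (A, C') => //=.
by rewrite Cm !eqxx (disjoint_sub (subxx A) sC).
Qed.

Lemma spr_lt_expander (R : realType) E m (b : R) : E \in regular_graphs n d ->
  E \notin unjoined n d m -> E \notin unexpanding_any n d -> 0 < m -> 32 * m <= n ->
  (4^-1 + (16 * m)%:R / n%:R < b)%R -> spr_lt E b.
Proof.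
move=> rE jE eE m0 mn lt_b; exists (4^-1 + (16 * m)%:R / n%:R)%R => // f Lf.
apply: (variance_le Lf) => // A C.
  exact: has_edge_joined.
exact: has_edge_expanding.
Qed.

(** Each of the two exceptional sets has probability at most [1 / n]. *)
Lemma prob_spr_lt_ge (R : realType) q m (b : R) : 0 < #|regular_graphs n d| ->
  0 < m -> 32 * m <= n -> 96 * (q * q) <= d -> 96 <= d -> n <= q * m ->
  12 * d <= m -> (4^-1 + (16 * m)%:R / n%:R < b)%R ->
  (1 - 2 / n%:R <= prob_spr_lt n d b)%R.
Proof.
move=> O0 m0 mn qd d96 nqm dm lt_b.
have n0 : 0 < n by lia.
have j := card_unjoined n0 qd nqm dm.
have e := @card_unexpanding_any n d d96 ltac:(lia).
rewrite /prob_spr_lt; set G := [set E in _ | _].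
have sub : regular_graphs n d \subset G :|: (unjoined n d m :|: unexpanding_any n d).
  apply/subsetP => E rE; rewrite !in_setU; apply: contraT.
  rewrite !negb_or => /and3P[nG jE eE]; case/negP: nG.
  by rewrite inE rE; apply/asboolP; apply: spr_lt_expander lt_b.
have card_le : #|regular_graphs n d| * n <= #|G| * n + 2 * #|regular_graphs n d|.
  have h1 := subset_leq_card sub.
  have h2 := leq_of_leqif (leq_card_setU G (unjoined n d m :|: unexpanding_any n d)).
  have h3 := leq_of_leqif (leq_card_setU (unjoined n d m) (unexpanding_any n d)).
  have h : #|regular_graphs n d| <= #|G| + (#|unjoined n d m| + #|unexpanding_any n d|).
    apply: leq_trans h1 (leq_trans h2 _).
    by rewrite leq_add2l.
  apply: leq_trans (leq_mul h (leqnn n)) _.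
  by rewrite !mulnDl leq_add2l mul2n -addnn leq_add.
have nR : (0 < n%:R :> R)%R by rewrite ltr0n.
have OR : (0 < #|regular_graphs n d|%:R :> R)%R by rewrite ltr0n.
rewrite ler_pdivlMr // mulrBl mul1r lerBlDr mulrAC -(ler_pM2r nR).
rewrite mulrDl divfK ?gt_eqF //.
by rewrite -!natrM -natrD ler_nat.
Qed.

End Assembly.

Theorem theorem5p2 (R : realType) (eps : R) (heps : 0 < eps) :
  exists d0 : nat, forall d : nat, (d0 <= d)%N ->
    forall delta : R, 0 < delta ->
      exists N : nat, forall n : nat, (N <= n)%N -> ~~ odd (n * d) ->
        1 - delta <= prob_spr_lt n d (4%:R^-1 + eps).
Proof.
(* With [m] about [n / q] and [m * q <= 2 * n], the error [16 m / n] is at most [32 / q], which is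
   below [eps]. The summand 64 ensures [32 * m <= n]. *)
pose q := (Num.bound (32 / eps) + 64)%N.
have q0 : (0 < q)%N by rewrite /q; lia.
have qR : 0 < q%:R :> R by rewrite ltr0n.
have q_eps : 32 < eps * q%:R.
  rewrite mulrC -ltr_pdivrMr // /q natrD.
  have h0 : 0 <= 32 / eps by rewrite divr_ge0 // ltW.
  have := archi_boundP h0.
  by move/lt_le_trans; apply; rewrite lerDl.
exists (96 * (q * q))%N => d qd delta delta0.
(* The first summand gives [12 * d <= m], the second gives [2 / n <= delta]. *)
exists (12 * d * q + Num.bound (2 / delta))%N => n Nn nd.
have d96 : (96 <= d)%N by nia.
have qn : (64 <= q)%N by rewrite /q; lia.
have nq : (12 * d * q <= n)%N by lia.
pose m := (n %/ q).+1.
have nm : (n <= q * m)%N by rewrite mulnC ltnW // ltn_ceil.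
have dm : (12 * d <= m)%N by rewrite ltnW // ltnS leq_divRL.
have qn2 : (q <= n)%N by nia.
have m2 : (m * q <= 2 * n)%N.
  by rewrite mul2n -addnn [leqLHS]mulSn leq_add // leq_trunc_div.
have mn : (32 * m <= n)%N by nia.
have n0 : (0 < n)%N by lia.
have nR : 0 < n%:R :> R by rewrite ltr0n.
have lt_eps : 4^-1 + (16 * m)%:R / n%:R < 4^-1 + eps.
  rewrite ltrD2l ltr_pdivrMr // -(ltr_pM2r qR).
  apply: (@le_lt_trans _ _ (32 * n%:R)).
    by rewrite -!natrM ler_nat; lia.
  by rewrite mulrAC ltr_pM2r.
have O0 : (0 < #|regular_graphs n d|)%N.
  case: n n0 nd {Nn nm dm qn2 m2 mn nR lt_eps m} nq => // n _ nd nq.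
  by apply: regular_graphs_gt0 => //; nia.
apply: le_trans (prob_spr_lt_ge O0 _ mn qd d96 nm dm lt_eps); last by [].
rewrite lerD2l lerN2 ler_pdivrMr // mulrC -ler_pdivrMr //.
apply: ltW; apply: lt_le_trans (archi_boundP _) _.
  by rewrite divr_ge0 // ltW.
by rewrite ler_nat (leq_trans (leq_addl _ _) Nn).
Qed.
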